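(* Let $\Theta=\mathbb{R}^d$ and let $F:\mathcal{P}_2(\Theta)\to(-\infty,+\infty]$ satisfy the following three conditions. (1) (Regularity) For every $\rho\in\mathcal{P}_2^a(\Theta)$ and every $\xi>0$ the set $prox_{F,\xi}(\rho)$ is nonempty, and $\mathcal{D}(F)\subset\mathcal{P}_2^a(\Theta)$. (2) (Minimum selection on the proximal trajectory) For every $\xi>0$, every $\rho\in\mathcal{D}(F)$ and every $\rho_\xi\in prox_{F,\xi}(\rho)$, the field $\nabla\frac{\delta F}{\delta\rho}(\rho_\xi)$ is a strong subdifferential of $F$ at $\rho_\xi$ and $$\left\Vert\nabla\frac{\delta F}{\delta\rho}(\rho_\xi)\right\Vert_{L_2(\rho_\xi)}\le\left\Vert\frac{T_{\rho_\xi}^{\rho}-\mathbf{id}}{\xi}\right\Vert_{L_2(\rho_\xi)}.$$ (3) (Wasserstein Polyak-Lojasiewicz inequality) There is $\mu>0$ such that for every $\rho\in\mathcal{D}(F)$ $$\int_\Theta\left\Vert\nabla\frac{\delta F}{\delta\rho}(\rho)\right\Vert^2d\rho\ge 2\mu\,(F(\rho)-F^* ),$$ where $F^*=F(\rho^* )$ and $\rho^*$ is any global minimizer of $F$. Then for any $\xi>0$, any $\rho_0\in\mathcal{D}(F)$ and any sequence $(\rho_n)_{n\ge0}$ with $\rho_{n+1}\in prox_{F,\xi}(\rho_n)$ for all $n\ge 0$, one has for all $n\ge0$ $$F(\rho_n)-F^*\le\frac{1}{(1+\xi\mu)^{2n}}\,(F(\rho_0)-F^* ).$$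
   Context: $\mathcal{P}_2(\Theta)$ is the set of Borel probability measures on $\Theta$ with finite second moment, $\mathcal{P}_2^a(\Theta)$ its subset of absolutely continuous measures, $\mathcal{W}_2$ the 2-Wasserstein distance. $\mathcal{D}(F)=\{\rho\in\mathcal{P}_2(\Theta): F(\rho)<\infty\}$. For $\rho\in\mathcal{P}_2^a(\Theta)$ and $\tilde\rho\in\mathcal{P}_2(\Theta)$, $T_\rho^{\tilde\rho}$ is the optimal transport map (quadratic cost) from $\rho$ to $\tilde\rho$; $\mathbf{id}$ is the identity map. A global minimizer $\rho^*$ of $F$ is taken to exist. Proximal operator (set-valued; the minimizer need not be unique): for $\xi>0$, $$prox_{F,\xi}(\rho)=\operatorname{arg\,min}_{\tilde\rho\in\mathcal{P}_2(\Theta)}\Big\{F(\tilde\rho)+\frac{1}{2\xi}\mathcal{W}_2^2(\tilde\rho,\rho)\Big\}.$$ First variation: $\frac{\delta F}{\delta\rho}(\rho):\Theta\to\mathbb{R}$ is a function with $\frac{d}{d\varepsilon}F(\rho+\varepsilon\chi)\big|_{\varepsilon=0}=\int\frac{\delta F}{\delta\rho}(\rho)\,d\chi$ (derivative from the right) for perturbations $\chi=\tilde\rho-\rho$, $\tilde\rho\in\mathcal{D}(F)$; $\nabla\frac{\delta F}{\delta\rho}(\rho)$ is its gradient in $\theta\in\Theta$. In the Polyak-Lojasiewicz inequality the left-hand side is $+\infty$ when this gradient is not an element of $L_2(\rho)$. Strong subdifferential: let $|\partial F|(\rho)=\limsup_{\mathcal{W}_2(\tilde\rho,\rho)\to0}\frac{(F(\rho)-F(\tilde\rho))^+}{\mathcal{W}_2(\rho,\tilde\rho)}$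 be the metric slope and $D(|\partial F|)$ the set of $\rho\in\mathcal{D}(F)$ where it is finite. For $\rho\in D(|\partial F|)$, $\mathbf{v}\in L^2(\rho;\Theta)$ belongs to the Frechet subdifferential $\partial F(\rho)$, and is called a strong subdifferential of $F$ at $\rho$, if $$F(\tilde\rho)\ge F(\rho)+\int_\Theta\langle\mathbf{v}(\theta),T_\rho^{\tilde\rho}(\theta)-\theta\rangle\,d\rho(\theta)+o(\mathcal{W}_2(\rho,\tilde\rho)).$$ *)

(* Defs.v *)
From HB Require Import structures.
From mathcomp Require Import all_boot all_order all_algebra.
From mathcomp Require Import all_classical all_reals all_analysis.
From mathcomp Require Import measurable_realfun.

Set Implicit Arguments.
Unset Strict Implicit.
Unset Printing Implicit Defensive.

Import Order.TTheory GRing.Theory Num.Theory.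
Import numFieldNormedType.Exports.

Local Open Scope classical_set_scope.
Local Open Scope ring_scope.

(* R^d is 'rV[R]_d with its Borel sigma-algebra. The library norm on 'rV[R]_d
   is the sup norm (same topology); the Euclidean one is enorm below. *)
Definition rV_display : measure_display. Proof. exact: default_measure_display. Qed.

Section rV_borel.
Context {R : realType} {d : nat}.

Definition rV_borel : set (set 'rV[R]_d) := <<s [set A | open A] >>.

Let borel0 : rV_borel set0. Proof. exact: sigma_algebra0. Qed.

Let borelC A : rV_borel A -> rV_borel (~` A).
Proof. exact: sigma_algebraC. Qed.

Let borelU (F : (set 'rV[R]_d)^nat) :
  (forall i, rV_borel (F i)) -> rV_borel (\bigcup_i F i).
Proof. exact: sigma_algebra_bigcup. Qed.

HB.instance Definition _ := @isMeasurable.Build rV_display 'rV[R]_d rV_borel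
  borel0 borelC borelU.

Lemma open_measurable_rV (A : set 'rV[R]_d) : open A -> measurable A.
Proof. by move=> oA; apply: sub_sigma_algebra. Qed.

Lemma continuous_measurable_rV (f : 'rV[R]_d -> R) :
  continuous f -> measurable_fun setT f.
Proof.
move=> cf; apply: (measurability _ (RGenOpens.measurableE R)).
move=> _ [_ [a [b ->]] <-]; rewrite setTI.
by apply: open_measurable_rV; move/continuousP: cf; apply; exact: interval_open.
Qed.

Lemma measurable_coord (i : 'I_d) :
  measurable_fun setT (fun v : 'rV[R]_d => v ord0 i).
Proof. by apply: continuous_measurable_rV; exact: coord_continuous. Qed.

Let ratball (p : 'rV[rat]_d * nat) : set 'rV[R]_d :=
  [set v | forall i, `|ratr (p.1 ord0 i) - v ord0 i| < p.2.+1%:R^-1].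

Lemma open_bigcup_ratball (U : set 'rV[R]_d) : open U ->
  U = \bigcup_(p in [set p | ratball p `<=` U]) ratball p.
Proof.
move=> oU; apply/seteqP; split=> [x Ux|x [p]]; last by apply.
have /nbhs_ballP[e /= e0 eU] : nbhs x U by exact: open_nbhs_nbhs.
pose n := Num.truncn (2 / e).
have ne : 2 / n.+1%:R < e.
  rewrite ltr_pdivrMr// mulrC -ltr_pdivrMr//.
  by rewrite /n truncnS_gt.
have n0 : (0 : R) < n.+1%:R^-1 by rewrite invr_gt0.
have /choice[q qP] : forall i, exists q : rat,
    `|ratr q - x ord0 i| < n.+1%:R^-1 :> R.
  move=> i; have /rat_in_itvoo[q /itvP qx] :
    x ord0 i - n.+1%:R^-1 < x ord0 i + n.+1%:R^-1.
    by rewrite ltrD2l gtrN.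
  by exists q; rewrite ltr_distl !qx.
exists (\row_i q i, n); last by move=> i/=; rewrite mxE.
move=> y yP; apply: eU; split => // i j.
rewrite (ord1 i) /ball /= (le_lt_trans (ler_distD (ratr (q j)) _ _))//.
apply: lt_trans ne; rewrite -[2]/(1 + 1) mulrDl mul1r ltrD//.
  by rewrite distrC.
by have := yP j; rewrite mxE.
Qed.

Lemma measurable_fun_rVP d' (T : measurableType d') (f : T -> 'rV[R]_d) :
  (forall i, measurable_fun setT (fun t => f t ord0 i)) ->
  measurable_fun setT f.
Proof.
move=> mf; apply: (measurability [set A : set 'rV[R]_d | open A]) => //.
move=> _ [A oA <-]; rewrite setTI (open_bigcup_ratball oA) preimage_bigcup.
rewrite bigcup_mkcond; apply: countable_bigcupT_measurable => // p.
case: ifPn => // _.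
have -> : f @^-1` ratball p = \bigcap_(i in [set: 'I_d])
    [set t | `|ratr (p.1 ord0 i) - f t ord0 i| < p.2.+1%:R^-1].
  by apply/seteqP; split => [t tp i _|t tp i]; exact: tp.
apply: fin_bigcap_measurable => // i _.
rewrite -[X in measurable X]setTI.
have mi : measurable_fun setT (fun t => `|ratr (p.1 ord0 i) - f t ord0 i|).
  by apply: measurableT_comp => //; exact: measurable_funB.
have -> : [set t | `|ratr (p.1 ord0 i) - f t ord0 i| < p.2.+1%:R^-1] =
  (fun t => `|ratr (p.1 ord0 i) - f t ord0 i|) @^-1` `]-oo, p.2.+1%:R^-1[.
  by apply/seteqP; split => t /=; rewrite in_itv.
exact: mi.
Qed.

End rV_borel.

Lemma sigma_finite_product d1 d2 (T1 : measurableType d1)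
    (T2 : measurableType d2) (R : realType)
    (m1 : {sigma_finite_measure set T1 -> \bar R})
    (m2 : {sigma_finite_measure set T2 -> \bar R}) :
  sigma_finite setT (m1 \x m2)%E.
Proof.
have /sigma_finiteP[F [TF ndF Foo]] := sigma_finiteT m1.
have /sigma_finiteP[G [TG ndG Goo]] := sigma_finiteT m2.
exists (fun n => F n `*` G n).
  rewrite -setXTT TF TG predeqE => -[x y]; split.
    move=> [/= [n _ Fnx] [k _ Gky]]; exists (maxn n k) => //; split.
    - by move: x Fnx; exact/subsetPset/ndF/leq_maxl.
    - by move: y Gky; exact/subsetPset/ndG/leq_maxr.
  by move=> [n _ []/= ? ?]; split; exists n.
move=> k; have [? ?] := Foo k; have [? ?] := Goo k.
split; first exact: measurableX.
by rewrite product_measure1E// lte_mul_pinfty// ge0_fin_numE.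
Qed.

Section rV_cons.
Context {R : realType} (d : nat).

Definition rV_cons (p : R * 'rV[R]_d) : 'rV[R]_d.+1 :=
  \row_i oapp (p.2 ord0) p.1 (unlift ord0 i).

Definition rV_behead (v : 'rV[R]_d.+1) : 'rV[R]_d :=
  \row_i v ord0 (lift ord0 i).

Lemma rV_consK p : (rV_cons p ord0 ord0, rV_behead (rV_cons p)) = p.
Proof.
case: p => x v; congr pair; first by rewrite mxE unlift_none.
by apply/rowP => i; rewrite !mxE liftK.
Qed.

Lemma measurable_rV_cons : measurable_fun setT rV_cons.
Proof.
apply: measurable_fun_rVP => i.
under eq_fun do rewrite mxE.
case: unliftP => [j|] _ /=; last exact: measurable_fst.
apply: (measurableT_comp (f := fun v : 'rV[R]_d => v ord0 j)) => //.
exact: measurable_coord.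
Qed.

Lemma measurable_rV_behead : measurable_fun setT rV_behead.
Proof.
apply: measurable_fun_rVP => i; under eq_fun do rewrite mxE.
exact: measurable_coord.
Qed.

Variable m : {sigma_finite_measure set 'rV[R]_d -> \bar R}.

(* the image under (x, y) |-> (x, y_1, .., y_d) of lebesgue_measure \x m *)
Definition lebesgue_step : set 'rV[R]_d.+1 -> \bar R :=
  pushforward (@lebesgue_measure R \x m)%E rV_cons.

HB.instance Definition _ := Measure.copy lebesgue_step
  (measure_function_pushforward__canonical__measure_function_Measure
     (@lebesgue_measure R \x m)%E measurable_rV_cons).

Let lebesgue_step_sigma_finite : sigma_finite setT lebesgue_step.
Proof.
have [F TF Foo] := sigma_finite_product (@lebesgue_measure R) m.
pose h (v : 'rV[R]_d.+1) := (v ord0 ord0, rV_behead v).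
have mh : measurable_fun setT h.
  by apply/measurable_fun_pairP; split; [exact: measurable_coord|exact: measurable_rV_behead].
exists (fun k => h @^-1` F k).
  by rewrite -preimage_bigcup -TF preimage_setT.
move=> k; have [mF Fk] := Foo k; split.
  by rewrite -[X in measurable X]setTI; exact: mh.
rewrite /lebesgue_step /pushforward -comp_preimage.
by rewrite (_ : h \o rV_cons = id)//; apply/funext => p /=; rewrite /h rV_consK.
Qed.

HB.instance Definition _ := Measure_isSigmaFinite.Build _ _ _ lebesgue_step
  lebesgue_step_sigma_finite.

End rV_cons.

Fixpoint lebesgue_rV {R : realType} (d : nat) :
    {sigma_finite_measure set 'rV[R]_d -> \bar R} :=
  match d with
  | 0 => [the {sigma_finite_measure set 'rV[R]_0 -> \bar R} of \d_(0 : 'rV[R]_0)]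
  | d'.+1 => [the {sigma_finite_measure set 'rV[R]_d'.+1 -> \bar R} of
               lebesgue_step (@lebesgue_rV R d')]
  end.

(* (1 - e) rho + e nu, i.e. rho + e (nu - rho), when 0 <= e <= 1 (the only
   relevant case); rho otherwise, so that it is always a probability. *)
Section mixture.
Local Open Scope ereal_scope.
Context {disp : measure_display} {T : measurableType disp} {R : realType}.
Variables (e : R) (rho nu : probability T R).

Definition mixture (A : set T) : \bar R :=
  if (0 <= e <= 1)%R then (1 - e)%:E * rho A + e%:E * nu A else rho A.

Let mixture0 : mixture set0 = 0.
Proof. by rewrite /mixture; case: ifP; rewrite ?measure0 ?mule0 ?adde0. Qed.

Let mixture_ge0 A : 0 <= mixture A.
Proof.
rewrite /mixture; case: ifP => // /andP[e0 e1].
by rewrite adde_ge0// mule_ge0// lee_fin// subr_ge0.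
Qed.

Let mixture_sigma_additive : semi_sigma_additive mixture.
Proof.
case: (boolP (0 <= e <= 1)%R) => e01; last first.
  rewrite (_ : mixture = rho); first exact: measure_semi_sigma_additive.
  by apply/funext => A; rewrite /mixture (negbTE e01).
have [e0 e1] := andP e01.
have e1' : (0 <= 1 - e)%R by rewrite subr_ge0.
rewrite (_ : mixture = measure_add (mscale (NngNum e1') rho)
                                   (mscale (NngNum e0) nu)).
  exact: measure_semi_sigma_additive.
by apply/funext => A; rewrite measure_addE /mixture e01.
Qed.

HB.instance Definition _ := isMeasure.Build _ _ _ mixture
  mixture0 mixture_ge0 mixture_sigma_additive.

Let mixture_setT : mixture setT = 1.
Proof.
rewrite /mixture; case: ifP => _; rewrite !probability_setT//.
by rewrite !mule1 -EFinD subrK.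
Qed.

HB.instance Definition _ := @Measure_isProbability.Build _ _ R mixture
  mixture_setT.

End mixture.

Section wasserstein.
Context {R : realType} {d : nat}.
Local Open Scope ereal_scope.

Local Notation Theta := 'rV[R]_d.
Local Notation prob := (probability Theta R).

Definition dotv (u v : Theta) : R := (\sum_i u ord0 i * v ord0 i)%R.
Definition enorm (u : Theta) : R := Num.sqrt (dotv u u).

Definition L2norm (rho : prob) (v : Theta -> Theta) : \bar R :=
  'N[rho]_2%:E[EFin \o (enorm \o v)].

Definition L2field (rho : prob) (v : Theta -> Theta) : Prop :=
  measurable_fun [set: Theta] v /\ L2norm rho v < +oo.

Definition P2 : set prob := [set rho | \int[rho]_x (enorm x ^+ 2)%:E < +oo].

Definition P2a : set prob := [set rho | P2 rho /\ rho `<< lebesgue_rV d].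

Definition coupling (rho nu : prob) : set (probability (Theta * Theta)%type R) :=
  [set g | forall A, measurable A ->
     g (fst @^-1` A) = rho A /\ g (snd @^-1` A) = nu A].

Definition W2 (rho nu : prob) : \bar R :=
  (ereal_inf [set \int[g]_z (enorm (z.1 - z.2)%R ^+ 2)%:E
             | g in coupling rho nu]) `^ 2^-1.

(* T is an optimal map: T pushes rho onto nu and the plan (id, T)#rho has the
   minimal Kantorovich cost W2(rho, nu)^2. *)
Definition optimal_map (rho nu : prob) (T : Theta -> Theta) : Prop :=
  [/\ measurable_fun [set: Theta] T,
      forall A, measurable A -> pushforward rho T A = nu A
    & \int[rho]_x (enorm (T x - x)%R ^+ 2)%:E = W2 rho nu ^+ 2].

(* D(F) *)
Definition fin_dom (F : prob -> \bar R) : set prob :=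
  [set rho | P2 rho /\ F rho < +oo].

Definition prox (F : prob -> \bar R) (xi : R) (rho : prob) : set prob :=
  [set nu | P2 nu /\ forall nu', P2 nu' ->
     F nu + (2 * xi)^-1%:E * W2 nu rho ^+ 2
     <= F nu' + (2 * xi)^-1%:E * W2 nu' rho ^+ 2].

(* The punctured W2-neighbourhoods of rho in P2. *)
Definition W2_dnbhs (rho : prob) : set_system prob :=
  [set U | exists2 r : R, (0 < r)%R &
     forall nu, P2 nu -> 0 < W2 rho nu < r%:E -> U nu].

Definition slope (F : prob -> \bar R) (rho : prob) : \bar R :=
  ereal_inf [set ereal_sup [set maxe (F rho - F nu) 0 / W2 rho nu | nu in U]
            | U in W2_dnbhs rho].

Definition slope_dom (F : prob -> \bar R) : set prob :=
  [set rho | fin_dom F rho /\ slope F rho < +oo].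

(* T rho nu stands for the optimal map from rho to nu. *)
Definition strong_subdifferential (F : prob -> \bar R)
    (T : prob -> prob -> Theta -> Theta) (rho : prob) (v : Theta -> Theta) :=
  [/\ slope_dom F rho, L2field rho v &
   forall eps : R, (0 < eps)%R -> \forall nu \near W2_dnbhs rho,
     F nu >= F rho + \int[rho]_x (dotv (v x) (T rho nu x - x)%R)%:E
             - eps%:E * W2 rho nu].

Definition is_first_variation (F : prob -> \bar R) (rho : prob)
    (phi : Theta -> R) : Prop :=
  forall nu, fin_dom F nu -> [/\ rho.-integrable setT (EFin \o phi),
    nu.-integrable setT (EFin \o phi)
  & (F (mixture e rho nu) - F rho) * e^-1%:E @[e --> 0^'+]
    --> \int[nu]_x (phi x)%:E - \int[rho]_x (phi x)%:E].

Definition loc_integrable (f : Theta -> R) : Prop :=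
  forall K : set Theta, compact K ->
    (lebesgue_rV d).-integrable K (EFin \o f).

Definition partial (i : 'I_d) (f : Theta -> R) (x : Theta) : R :=
  'D_(delta_mx ord0 i) f x.

Definition C1c (psi : Theta -> R) : Prop :=
  [/\ forall x, differentiable psi x,
      forall i, continuous (partial i psi)
    & exists2 K : set Theta, compact K & forall x, ~ K x -> psi x = 0%R].

(* v is the gradient of phi in the Sobolev sense. A gradient that only has to
   be an element of L2(rho) cannot be asked to exist at every point (kinks), nor
   be the almost everywhere classical one (which would ignore jumps). It is
   unique Lebesgue-almost everywhere, hence rho-almost everywhere for rho in P2a. *)
Definition is_gradient (phi : Theta -> R) (v : Theta -> Theta) : Prop :=
  loc_integrable phi /\ forall i : 'I_d,
    loc_integrable (fun x => v x ord0 i) /\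
    forall psi, C1c psi ->
      \int[lebesgue_rV d]_x (phi x * partial i psi x)%:E
      = - \int[lebesgue_rV d]_x (v x ord0 i * psi x)%:E.

(* v is the gradient of the first variation dF rho of F at rho. A first
   variation need not exist at every rho in D(F) (for the entropy it fails if rho
   vanishes on an open set), so dF rho is meaningful only where one exists. *)
Definition grad_first_variation (F : prob -> \bar R) (dF : prob -> Theta -> R)
    (rho : prob) (v : Theta -> Theta) : Prop :=
  is_first_variation F rho (dF rho) /\ is_gradient (dF rho) v.

(* The integral of the squared norm of the gradient of the first variation;
   +oo (infimum of the empty set) if there is no such gradient in L2(rho). *)
Definition grad_energy (F : prob -> \bar R) (dF : prob -> Theta -> R)
    (rho : prob) : \bar R :=
  ereal_inf [set \int[rho]_x (enorm (v x) ^+ 2)%:E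
            | v in [set v | grad_first_variation F dF rho v /\ L2field rho v]].

End wasserstein.

(* Main.v *)
Require Import Defs.
From HB Require Import structures.
From mathcomp Require Import all_boot all_order all_algebra.
From mathcomp Require Import all_classical all_reals all_analysis.
From mathcomp Require Import measurable_realfun.
From mathcomp Require Import ring lra.

(** The argument is a differential inequality for the Moreau envelope of the
    functional along the proximal parameter.  Fix rho in the domain of F, let
    rho_t be a point of prox F t rho for every t > 0, and put
    f t = F rho_t - F rho_star, w t = W2 (rho_t, rho)^2 and
    g t = f t + w t / (2 t), the Moreau envelope of F at rho minus the minimum.
    The minimum selection bounds the energy of the gradient at rho_t by
    w t / t^2, because the optimal displacement from rho_t to rho has squared
    L2 norm w t; the Polyak-Lojasiewicz inequality therefore becomes
    2 mu f t <= w t / t^2.  On the other hand g' t = - w t / (2 t^2), since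
    the derivative of a minimum is the partial derivative at the minimizer.
    Together these say g' <= - mu / (1 + mu t) g, so that (1 + mu t) g t is
    nonincreasing; its limit at 0 is at most F rho - F rho_star, and once more
    by Polyak-Lojasiewicz (1 + mu t) f t <= g t.  Hence
    (1 + mu t)^2 f t <= F rho - F rho_star ([prox_contraction]), and iterating
    this along the proximal sequence gives the rate.

    No differentiability of g is established: comparing the minimizers at two
    parameters s < t gives the differential inequality up to an error of order
    (t - s)^2, which a subdivision of the interval makes negligible
    ([nonincreasing_of_quadratic_defect], [envelope_contraction]). *)

Set Implicit Arguments.
Unset Strict Implicit.
Unset Printing Implicit Defensive.

Import Order.TTheory GRing.Theory Num.Theory.
Import numFieldNormedType.Exports.

Local Open Scope classical_set_scope.
Local Open Scope ring_scope.

(** * A differential inequality without derivatives *)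

Lemma le_of_vanishing_defect (R : realType) (a b K : R) :
  (forall n : nat, a <= b + K / n.+1%:R) -> a <= b.
Proof.
move=> ab; apply/ler_addgt0Pr => e e0.
have [K0|K0] := leP K 0.
  apply: (le_trans (ab 0%N)); rewrite divr1; lra.
apply: (le_trans (ab (Num.truncn (K / e)))); rewrite lerD2l.
rewrite ler_pdivrMr ?ltr0n// mulrC -ler_pdivrMr//.
exact/ltW/truncnS_gt.
Qed.

(** The discrete counterpart of a nonpositive derivative: over n steps of
    length (b - a) / n the defects add up to K (b - a)^2 / n. *)
Lemma nonincreasing_of_quadratic_defect (R : realType) (h : R -> R) (a b K : R) :
  a <= b ->
  (forall s t, a <= s -> s <= t -> t <= b -> h t <= h s + K * (t - s) ^+ 2) ->
  h b <= h a.
Proof.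
move=> ab hK; apply: (@le_of_vanishing_defect _ _ _ (K * (b - a) ^+ 2)) => n.
set D := (b - a) / n.+1%:R.
have n0 : n.+1%:R != 0 :> R by rewrite pnatr_eq0.
have D0 : 0 <= D by rewrite /D divr_ge0// subr_ge0.
have Db : a + n.+1%:R * D = b by rewrite /D mulrC divfK// addrC subrK.
have step k : (k <= n.+1)%N -> h (a + k%:R * D) <= h a + k%:R * (K * D ^+ 2).
  elim: k => [|k IH] kn; first by rewrite !mul0r !addr0.
  have kD0 : 0 <= k%:R * D by rewrite mulr_ge0.
  have eSk : k.+1%:R * D = k%:R * D + D by rewrite -natr1 mulrDl mul1r.
  have kD1 : k.+1%:R * D <= n.+1%:R * D by rewrite ler_wpM2r// ler_nat.
  have := hK (a + k%:R * D) (a + k.+1%:R * D).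
  have -> : a + k.+1%:R * D - (a + k%:R * D) = D by rewrite eSk; ring.
  move=> /(_ _ _ _)/le_trans; apply; [lra|lra|lra|].
  by rewrite -natr1 mulrDl mul1r addrA lerD2r; apply: IH; exact: ltnW.
have := step n.+1 (leqnn _); rewrite Db => /le_trans; apply.
rewrite lerD2l /D le_eqVlt; apply/orP; left; apply/eqP; field.
by rewrite addrC natr1.
Qed.

Section envelope.
Context (R : realType) (mu f0 : R) (f w : R -> R).
Context (mu0 : 0 < mu)
  (f_ge0 : forall t, 0 < t -> 0 <= f t)
  (w_ge0 : forall t, 0 < t -> 0 <= w t)
  (f_min : forall s t, 0 < s -> 0 < t ->
    f t + w t / (2 * t) <= f s + w s / (2 * t))
  (f_le0 : forall t, 0 < t -> f t + w t / (2 * t) <= f0)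
  (PL : forall t, 0 < t -> 2 * mu * f t <= w t / t ^+ 2).

Let g t := f t + w t / (2 * t).

(** On the envelope g the Polyak-Lojasiewicz inequality gains the factor that
    makes the differential inequality g' = - w / (2 t^2) <= - mu / (1 + mu t) g
    close. *)
Let PL_g s : 0 < s -> 2 * mu * g s <= (1 + mu * s) * (w s / s ^+ 2).
Proof.
move=> s0; rewrite /g mulrDr.
have -> : (1 + mu * s) * (w s / s ^+ 2) = w s / s ^+ 2 + 2 * mu * (w s / (2 * s)).
  by field; rewrite gt_eqF.
by rewrite lerD2r; exact: PL.
Qed.

(** Integrated form of that differential inequality, with denominators cleared:
    the minimizer at s is a competitor at t, so g s - g t is at least
    w s / 2 (1 / s - 1 / t). *)
Let g_decr s t : 0 < s -> s <= t ->
  (1 + mu * s) * (g s - g t) * t >= mu * s * (t - s) * g s.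
Proof.
move=> s0 st; have t0 := lt_le_trans s0 st.
have := f_min s0 t0; rewrite -[f t + _]/(g t).
have -> : f s + w s / (2 * t) = g s - (w s / s ^+ 2) * (s * (t - s)) / (2 * t).
  by rewrite /g; field; rewrite !gt_eqF.
set a := w s / s ^+ 2 => gt.
have c0 : 0 <= s * (t - s) by rewrite mulr_ge0 ?subr_ge0// ltW.
have := ler_wpM2r c0 (PL_g s0); rewrite -/a => P.
have ms : 0 < 1 + mu * s by rewrite addr_gt0// mulr_gt0.
have : a * (s * (t - s)) / (2 * t) <= g s - g t by lra.
rewrite ler_pdivrMr ?mulr_gt0// => Q.
have := ler_wpM2l (ltW ms) Q.
nra.
Qed.

(** In the intended use f t + w t / (2 t) is the minimal value of a functional
    with penalty w / (2 t), and f0 its value at the point from which w measures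
    the squared distance.  One factor 1 + mu t comes from the decay of the
    envelope, the other from the comparison of f with the envelope. *)
Lemma envelope_contraction t : 0 < t -> (1 + mu * t) ^+ 2 * f t <= f0.
Proof.
move=> t0.
have g0 s : 0 < s -> 0 <= g s.
  by move=> s0; rewrite addr_ge0 ?f_ge0// divr_ge0 ?w_ge0// mulr_ge0// ltW.
have f00 : 0 <= f0 := le_trans (g0 _ t0) (f_le0 t0).
pose h s := (1 + mu * s) * g s.
have hmono e : 0 < e -> e <= t -> h t <= h e.
  move=> e0 et.
  apply: (@nonincreasing_of_quadratic_defect _ h e t (mu * f0 / e)) => //.
  move=> s r es sr rt.
  have s0 := lt_le_trans e0 es; have r0 := lt_le_trans s0 sr.
  have ms : 1 <= 1 + mu * s by rewrite lerDl mulr_ge0// ltW.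
  have gs0 := g0 _ s0; have gsf := f_le0 s0; rewrite -/(g s) in gsf.
  have := g_decr s0 sr => D.
  have grs : g r <= g s.
    have : 0 <= (1 + mu * s) * (g s - g r) * r.
      by apply: le_trans D; rewrite !mulr_ge0// ?subr_ge0// ltW.
    by rewrite pmulr_lge0// pmulr_rge0 ?subr_ge0//; lra.
  (* (1 + mu r) g r = (1 + mu s) g r + mu (r - s) g r: g_decr handles the first
     term, and g r <= g s the second. *)
  have H : (h r - h s) * r <= mu * (r - s) ^+ 2 * g s.
    have : 0 <= mu * (r - s) * r * (g s - g r).
      by rewrite !mulr_ge0 ?subr_ge0// ltW.
    by rewrite /h; nra.
  have {}H : (h r - h s) * r <= mu * f0 * (r - s) ^+ 2.
    apply: (le_trans H); rewrite mulrAC ler_wpM2r ?sqr_ge0// ler_wpM2l//.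
    exact: ltW.
  (* The constant must not depend on r, whence r is replaced by its lower bound
     e. *)
  have {}H : (h r - h s) * e <= mu * f0 * (r - s) ^+ 2.
    have [hrs|hsr] := leP (h r) (h s).
      apply: (@le_trans _ _ 0); first by rewrite mulr_le0_ge0 ?subr_le0// ltW.
      by rewrite mulr_ge0 ?sqr_ge0// mulr_ge0 ?(ltW mu0).
    by apply: le_trans H; rewrite ler_wpM2l ?(le_trans es sr)// subr_ge0 ltW.
  by rewrite -lerBlDl mulrAC ler_pdivlMr.
have hf0 : h t <= f0.
  apply/ler_addgt0Pr => e e0.
  have muf : 0 < 1 + mu * f0 by rewrite ltr_wpDr// mulr_ge0// ltW.
  (* h s <= (1 + mu s) f0 exceeds f0 by mu s f0; the extra 1 keeps the quotient
     meaningful when f0 = 0. *)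
  pose s := Num.min t (e / (1 + mu * f0)).
  have s0 : 0 < s by rewrite lt_min t0 divr_gt0.
  have st : s <= t by rewrite ge_min lexx.
  apply: (le_trans (hmono _ s0 st)).
  have ms : 0 <= 1 + mu * s by rewrite addr_ge0// mulr_ge0// ltW.
  apply: (le_trans (ler_wpM2l ms (f_le0 s0))).
  have : s * (1 + mu * f0) <= e by rewrite -ler_pdivlMr// ge_min lexx orbT.
  nra.
(* It remains that (1 + mu t) f t <= g t, which is PL. *)
apply: le_trans hf0; rewrite /h expr2 -mulrA ler_wpM2l//.
  by rewrite addr_ge0// mulr_ge0// ltW.
rewrite /g mulrDl mul1r lerD2l.
have -> : w t / (2 * t) = (w t / t ^+ 2) * (t / 2) by field; rewrite gt_eqF.
have -> : mu * t * f t = (2 * mu * f t) * (t / 2) by field.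
by rewrite ler_wpM2r ?PL// divr_ge0// ltW.
Qed.

End envelope.

Local Open Scope ereal_scope.

(** * Squared norms and the Wasserstein distance *)

Section wasserstein_norms.
Context {R : realType} {d : nat}.
Implicit Types (u : 'rV[R]_d) (rho nu : probability 'rV[R]_d R).

Lemma enorm_sqr u : (enorm u ^+ 2 = dotv u u)%R.
Proof.
by rewrite /enorm sqr_sqrtr//; apply: sumr_ge0 => i _; rewrite -expr2 sqr_ge0.
Qed.

Lemma enorm_sqrZ (k : R) u : (enorm (k *: u) ^+ 2 = k ^+ 2 * enorm u ^+ 2)%R.
Proof.
rewrite !enorm_sqr /dotv mulr_sumr; apply: eq_bigr => i _; rewrite !mxE; ring.
Qed.

Lemma measurable_enorm_sqr disp (X : measurableType disp) (f : X -> 'rV[R]_d) :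
  measurable_fun setT f -> measurable_fun setT (fun x => (enorm (f x) ^+ 2)%R).
Proof.
move=> mf; under eq_fun do rewrite enorm_sqr /dotv.
apply: measurable_sum => i.
have mi : measurable_fun setT (fun x => f x ord0 i).
  exact: (measurableT_comp (measurable_coord i) mf).
exact: measurable_funM.
Qed.

Lemma measurable_rVB disp (X : measurableType disp) (f g : X -> 'rV[R]_d) :
  measurable_fun setT f -> measurable_fun setT g ->
  measurable_fun setT (fun x => (f x - g x)%R).
Proof.
move=> mf mg; apply: measurable_fun_rVP => i; under eq_fun do rewrite !mxE.
apply: measurable_funB.
  exact: (measurableT_comp (measurable_coord i) mf).
exact: (measurableT_comp (measurable_coord i) mg).
Qed.

Lemma poweR2 (x : \bar R) : 0 <= x -> x `^ 2 = x ^+ 2.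
Proof.
case: x => [x| |]//= x0; first by rewrite powR_mulrn// EFin_expe.
by rewrite pnatr_eq0.
Qed.

Lemma L2norm_sqr rho (v : 'rV[R]_d -> 'rV[R]_d) :
  L2norm rho v ^+ 2 = \int[rho]_x (enorm (v x) ^+ 2)%:E.
Proof.
rewrite /L2norm -poweR2 ?Lnorm_ge0// poweR_Lnorm//.
apply: eq_integral => x _ /=.
by rewrite powR_mulrn ?normr_ge0// ger0_norm ?sqrtr_ge0.
Qed.

(** The coupling of a measure with itself that moves no mass is its image under
    this map. *)
Definition diagonal (x : 'rV[R]_d) := (x, x).

Lemma measurable_diagonal : measurable_fun setT diagonal.
Proof. by apply/measurable_fun_pairP; split; exact: measurable_id. Qed.

HB.instance Definition _ := isMeasurableFun.Build _ _ _ _ diagonal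
  measurable_diagonal.

Lemma W2_ge0 rho nu : 0 <= W2 rho nu.
Proof. exact: poweR_ge0. Qed.

Lemma W2xx rho : W2 rho rho = 0.
Proof.
rewrite /W2; set I := ereal_inf _; suff -> : I = 0 by rewrite poweR0r.
apply/eqP; rewrite eq_le; apply/andP; split; last first.
  apply: le_ereal_inf_tmp => _ [g _ <-]; apply: integral_ge0 => z _.
  by rewrite lee_fin sqr_ge0.
apply: ge_ereal_inf; eexists.
  by exists (distribution rho diagonal).
rewrite ge0_integral_distribution.
- rewrite (eq_integral (cst 0)) ?integral0// => x _ /=.
  by rewrite subrr enorm_sqr /dotv big1// => i _; rewrite mxE mul0r.
- apply/measurable_EFinP/measurable_enorm_sqr/measurable_rVB.
    exact: measurable_fst.
  exact: measurable_snd.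
- by move=> z; rewrite lee_fin sqr_ge0.
Qed.

(** This turns the minimum selection into a bound in terms of W2: the optimal
    displacement realizes the distance. *)
Lemma L2norm_displacement_sqr rho nu (t : R) (S : 'rV[R]_d -> 'rV[R]_d) :
  optimal_map rho nu S ->
  L2norm rho (fun x => t^-1 *: (S x - x))%R ^+ 2 = (t ^- 2)%:E * W2 rho nu ^+ 2.
Proof.
case=> mS _ <-; rewrite L2norm_sqr; under eq_integral do rewrite enorm_sqrZ EFinM.
rewrite ge0_integralZl_EFin//.
- by rewrite exprVn.
- by move=> x _; rewrite lee_fin sqr_ge0.
- by apply/measurable_EFinP/measurable_enorm_sqr/measurable_rVB.
- exact: sqr_ge0.
Qed.

Lemma grad_energy_le F dF rho (v : 'rV[R]_d -> 'rV[R]_d) :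
  grad_first_variation F dF rho v -> L2field rho v ->
  grad_energy F dF rho <= L2norm rho v ^+ 2.
Proof.
by move=> gv v2; apply: ereal_inf_lbound; exists v => //; rewrite L2norm_sqr.
Qed.

End wasserstein_norms.

(** * One proximal step *)

Section proximal_step.
Context {R : realType} {d : nat}.
Implicit Types (rho nu : probability 'rV[R]_d R).

(** The base point is itself a competitor, at distance 0. *)
Lemma prox_le F (t : R) rho nu : P2 rho -> prox F t rho nu ->
  F nu + (2 * t)^-1%:E * W2 nu rho ^+ 2 <= F rho.
Proof.
move=> rho2 [_ /(_ _ rho2)]/le_trans; apply.
by rewrite W2xx expe2 mule0 mule0 adde0.
Qed.

Lemma prox_fin_num F (t : R) rho nu : (0 < t)%R -> -oo < F nu ->
  fin_dom F rho -> prox F t rho nu ->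
  F nu \is a fin_num /\ W2 nu rho ^+ 2 \is a fin_num.
Proof.
move=> t0 Fnu [rho2 Frho] /(prox_le rho2)/le_lt_trans/(_ Frho).
have w0 : 0 <= W2 nu rho ^+ 2 by rewrite expe_ge0// W2_ge0.
have c0 : (0 < (2 * t)^-1)%R by rewrite invr_gt0 mulr_gt0.
move: (F nu) (W2 nu rho ^+ 2) Fnu w0 => [x| |] [r| |]//= _ _.
by rewrite gt0_muley ?lte_fin.
by rewrite gt0_muley ?lte_fin.
Qed.

(** The Polyak-Lojasiewicz inequality is needed at the proximal points of rho
    for all parameters, even though the conclusion concerns a single one: the
    proof moves the parameter from 0 to t. *)
Lemma prox_contraction F rho (Fmin mu : R) : (0 < mu)%R ->
  (forall nu, P2 nu -> Fmin%:E <= F nu) ->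
  fin_dom F rho ->
  (forall t : R, (0 < t)%R -> prox F t rho !=set0) ->
  (forall (t : R) nu, (0 < t)%R -> prox F t rho nu ->
     (2 * mu)%:E * (F nu - Fmin%:E) <= (t ^- 2)%:E * W2 nu rho ^+ 2) ->
  forall (t : R) nu, (0 < t)%R -> prox F t rho nu ->
    F nu - Fmin%:E <= (((1 + t * mu) ^+ 2)^-1)%:E * (F rho - Fmin%:E).
Proof.
move=> mu0 minF rhoF prox0 PL t nu t0 nut.
have rho2 := rhoF.1.
(* A choice of proximal points for all parameters that goes through nu at t. *)
have [J [Jt JP]] : exists J : R -> probability 'rV[R]_d R,
    J t = nu /\ forall s, (0 < s)%R -> prox F s rho (J s).
  have /choice[J JP] : forall s, exists nu', (0 < s)%R -> prox F s rho nu'.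
    move=> s; have [s0|s0] := ltP 0%R s; last by exists nu.
    by have [nu' ?] := prox0 _ s0; exists nu'.
  exists (fun s => if s == t then nu else J s); split; first by rewrite eqxx.
  by move=> s s0; case: eqP => [->//|_]; exact: JP.
have finP nu' : P2 nu' -> -oo < F nu'.
  by move=> /minF; apply: lt_le_trans; rewrite ltNyr.
have J2 s : (0 < s)%R -> P2 (J s) by move=> /JP[].
have Jfin s (s0 : (0 < s)%R) := prox_fin_num s0 (finP _ (J2 _ s0)) rhoF (JP _ s0).
have rhofin : F rho \is a fin_num by rewrite fin_real// finP// rhoF.2.
pose f s := (fine (F (J s)) - Fmin)%R.
pose w s := fine (W2 (J s) rho ^+ 2).
have Ff s : (0 < s)%R -> F (J s) = (f s + Fmin)%:E.
  by move=> /Jfin[? _]; rewrite /f subrK fineK.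
have Ww s : (0 < s)%R -> W2 (J s) rho ^+ 2 = (w s)%:E.
  by move=> /Jfin[_ ?]; rewrite /w fineK.
rewrite -Jt (Ff _ t0) -(fineK rhofin) -!EFinB -EFinM lee_fin addrK.
rewrite mulrC ler_pdivlMr ?exprn_gt0 ?addr_gt0 ?mulr_gt0// mulrC [(t * mu)%R]mulrC.
apply: (@envelope_contraction _ mu _ f w) => //.
- by move=> s s0; have := minF _ (J2 _ s0); rewrite (Ff _ s0) lee_fin lerDr.
- by move=> s s0; rewrite -lee_fin -Ww// expe_ge0// W2_ge0.
- move=> s r s0 r0; have := (JP _ r0).2 _ (J2 _ s0).
  rewrite !Ff// !Ww// -!EFinM -!EFinD lee_fin addrAC [leRHS]addrAC lerD2r.
  by rewrite ![(_^-1 * _)%R]mulrC.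
- move=> s s0; have := prox_le rho2 (JP _ s0).
  rewrite Ff// Ww// -EFinM -EFinD -(fineK rhofin) lee_fin.
  by rewrite addrAC [(_^-1 * _)%R]mulrC lerBrDr.
- move=> s s0; have := PL _ _ s0 (JP _ s0).
  by rewrite Ff// Ww// -EFinB -!EFinM lee_fin addrK [(s ^- 2 * _)%R]mulrC.
Qed.
End proximal_step.

(** * Convergence rate *)

Theorem theorem3p3 (R : realType) (d : nat)
  (F : probability 'rV[R]_d R -> \bar R)
  (F_gtNy : forall rho, P2 rho -> -oo < F rho)
  (* optimal transport maps and first variations *)
  (T : probability 'rV[R]_d R -> probability 'rV[R]_d R -> 'rV[R]_d -> 'rV[R]_d)
  (T_optimal : forall rho nu, P2a rho -> P2 nu -> optimal_map rho nu (T rho nu))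
  (dF : probability 'rV[R]_d R -> 'rV[R]_d -> R)
  (dF_first_variation : forall rho, fin_dom F rho ->
     (exists phi, is_first_variation F rho phi) ->
     is_first_variation F rho (dF rho))
  (* global minimizer *)
  (rho_star : probability 'rV[R]_d R)
  (rho_star_P2 : P2 rho_star)
  (rho_star_min : forall rho, P2 rho -> F rho_star <= F rho)
  (* (1) regularity *)
  (prox_neq0 : forall (xi : R) rho, (0 < xi)%R -> P2a rho -> prox F xi rho !=set0)
  (fin_dom_ac : fin_dom F `<=` @P2a R d)
  (* (2) minimum selection on the proximal trajectory *)
  (min_selection : forall (xi : R) rho rho_xi, (0 < xi)%R -> fin_dom F rho ->
     prox F xi rho rho_xi ->
     exists v, [/\ grad_first_variation F dF rho_xi v,
       strong_subdifferential F T rho_xi v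
     & L2norm rho_xi v
       <= L2norm rho_xi (fun x => xi^-1 *: (T rho_xi rho x - x))%R])
  (* (3) Polyak-Lojasiewicz inequality *)
  (mu : R) (mu_gt0 : (0 < mu)%R)
  (PL : forall rho, fin_dom F rho ->
     (2 * mu)%:E * (F rho - F rho_star) <= grad_energy F dF rho) :
  forall (xi : R) (rho_ : nat -> probability 'rV[R]_d R), (0 < xi)%R ->
    fin_dom F (rho_ 0%N) ->
    (forall n, prox F xi (rho_ n) (rho_ n.+1)) ->
    forall n : nat, F (rho_ n) - F rho_star
      <= (((1 + xi * mu) ^+ (2 * n))^-1)%:E * (F (rho_ 0%N) - F rho_star).
Proof.
move=> xi rho_ xi0 rho0 stepP.
have Fs_fin : F rho_star \is a fin_num.
  by rewrite fin_real// F_gtNy// (le_lt_trans (rho_star_min _ rho0.1) rho0.2).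
have min_fine nu : P2 nu -> (fine (F rho_star))%:E <= F nu.
  by rewrite fineK//; exact: rho_star_min.
have prox_dom (t : R) rho nu : (0 < t)%R -> fin_dom F rho -> prox F t rho nu ->
    fin_dom F nu.
  move=> t0 rhoF nut; split; first exact: nut.1.
  by have [/fin_numPlt/andP[]] := prox_fin_num t0 (F_gtNy _ nut.1) rhoF nut.
have energy (t : R) rho nu : (0 < t)%R -> fin_dom F rho -> prox F t rho nu ->
    (2 * mu)%:E * (F nu - F rho_star) <= (t ^- 2)%:E * W2 nu rho ^+ 2.
  move=> t0 rhoF nut; have nuF := prox_dom _ _ _ t0 rhoF nut.
  have [v [gv [_ v2 _] vT]] := min_selection _ _ _ t0 rhoF nut.
  apply: (le_trans (PL _ nuF)); apply: (le_trans (grad_energy_le gv v2)).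
  rewrite -(L2norm_displacement_sqr _ (T_optimal _ _ (fin_dom_ac _ nuF) rhoF.1)).
  by rewrite !expe2 lee_pmul// Lnorm_ge0.
have dom n : fin_dom F (rho_ n).
  by elim: n => // n IH; exact: (prox_dom _ _ _ xi0 IH (stepP n)).
elim=> [|n IH]; first by rewrite muln0 expr0 invr1 mul1e.
have := prox_contraction mu_gt0 min_fine (dom n)
  (fun t t0 => prox_neq0 t _ t0 (fin_dom_ac _ (dom n))).
rewrite fineK// => /(_ (fun t nu t0 => energy t _ nu t0 (dom n)) _ _ xi0 (stepP n)).
move=> /le_trans; apply.
have -> : ((1 + xi * mu) ^+ (2 * n.+1))^-1%R =
    (((1 + xi * mu) ^+ 2)^-1 * ((1 + xi * mu) ^+ (2 * n))^-1)%R.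
  by rewrite mulnS exprD invfM.
rewrite EFinM -muleA; apply: lee_wpmul2l => //.
by rewrite lee_fin invr_ge0 exprn_ge0// addr_ge0// mulr_ge0// ltW.
Qed.
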